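(* Let $z\in\Lambda_\phi$ and let $C_{z,n-1}$ denote the coefficient of $t^{n-1}$ in the $\mathfrak{f}$-remainder $[\omega_z(t)]_{\mathfrak{f}}$. Then $$[\omega_z(t)]_{\mathfrak{f}}=\operatorname{O}^{(2)}_{\mathfrak{f}}(x,t)\diamond_\phi(C_{z,n-1})=\sum_{i=0}^{n-1}\Big(\operatorname{D}_{\mathfrak{f}}(x^i)\diamond_\phi C_{z,n-1}\Big)t^i .$$
   Context: Let $\mathbb{F}_q$ be the finite field with $q$ elements, $\theta$ transcendental over $\mathbb{F}_q$, $K_\infty=\mathbb{F}_q((1/\theta))$ with $|\theta|=q$, and $\mathbb{C}_\infty$ the completion of an algebraic closure of $K_\infty$. Let $\phi$ be a Drinfeld $\mathbb{F}_q[x]$-module of rank $r\ge1$, $\phi_x=\theta+g_1\tau+\cdots+g_r\tau^r$ with $g_i\in\mathbb{C}_\infty$, $g_r\ne0$, $\tau$ the $q$-Frobenius; $\exp_\phi(\mu)=\sum_{i\ge0}\mu^{q^i}/D_i$ its exponential and $\Lambda_\phi=\ker\exp_\phi$ its lattice. For $z$, $\omega_z(t)=\sum_{k\ge0}\exp_\phi(z/\theta^{k+1})t^k$, an element of the Tate algebra $\mathbb{T}=\{\sum c_it^i\in\mathbb{C}_\infty[[t]]:|c_i|\to0\}$. Let $\mathfrak{f}(t)=a_nt^n+\cdots+a_0\in\mathbb{F}_q[t]$ be monic of degree $n\ge1$. The $\mathfrak{f}$-remainder $[\omega]_{\mathfrak{f}}$ of $\omega\in\mathbb{T}$ is the unique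 polynomial in $\mathbb{C}_\infty[t]$ of degree $<n$ with $\omega-[\omega]_{\mathfrak{f}}\in\mathfrak{f}\mathbb{T}$ (i.e. representing the image of $\omega$ under the continuous extension $\mathbb{T}\to\mathbb{C}_\infty[t]/(\mathfrak{f})$ of the quotient map). $\operatorname{D}_{\mathfrak{f}}$ is the $\mathbb{F}_q$-linear map with $\operatorname{D}_{\mathfrak{f}}(x^i)=\sum_{j=0}^{n-i-1}a_{i+j+1}x^j$ for $0\le i\le n-1$, and $\operatorname{O}^{(2)}_{\mathfrak{f}}(x,t)=\sum_{k=0}^{n-1}\operatorname{D}_{\mathfrak{f}}(x^k)t^k$. The Drinfeld action: for $b(x,t)=\sum_ib_i(t)x^i$ with $b_i\in\mathbb{F}_q[t]$ and $\mu\in\mathbb{C}_\infty$, $b\diamond_\phi\mu=\sum_ib_i(t)\phi_{x^i}(\mu)$ (elements of $\mathbb{F}_q[t]$ act as scalars). *)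

(* Defs.v *)
From mathcomp Require Import all_boot all_order all_algebra.
From mathcomp Require Import boolp classical_sets reals topology normedtype sequences.
From mathcomp Require Import finfield zify ring lra.

Set Implicit Arguments.
Unset Strict Implicit.
Unset Printing Implicit Defensive.

Import Order.TTheory GRing.Theory Num.Theory.
Import numFieldNormedType.Exports.

Local Open Scope classical_set_scope.
Local Open Scope ring_scope.

Definition abs_cvg (R : realType) (V : zmodType) (abs : V -> R)
  (u : nat -> V) (l : V) : Prop := abs (u n - l) @[n --> \oo] --> 0.

Definition abs_cauchy (R : realType) (V : zmodType) (abs : V -> R)
    (u : nat -> V) : Prop :=
  forall e : R, 0 < e ->
    exists N : nat, forall m n, (N <= m)%N -> (N <= n)%N -> abs (u m - u n) < e.

(* The copy of F((1/theta)) inside a valued field containing F and theta: the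
   sums of the convergent series theta^N * sum_i c_i theta^-i. *)
Definition laurent (R : realType) (F : finFieldType) (C : fieldType)
    (abs : C -> R) (iota : F -> C) (theta : C) : set C :=
  [set y | exists (N : nat) (c : nat -> F),
     abs_cvg abs (fun n => theta ^+ N * \sum_(i < n) iota (c i) * theta ^- i) y].

Definition algebraic_over (C : fieldType) (S : set C) (y : C) : Prop :=
  exists2 p : {poly C}, p != 0 /\ (forall i, S p`_i) & root p y.

(* The completion of an algebraic closure of F((1/theta)), given by its
   characterization up to isometric isomorphism: a complete, algebraically
   closed, non-archimedean valued field containing F and theta with
   |theta| = #|F|, in which the elements algebraic over F((1/theta)) are dense.
   That theta is transcendental over F and that the absolute value is trivial
   on F both follow. *)
Record Cinfty (R : realType) (F : finFieldType) := MkCinfty {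
  Cfield :> closedFieldType;
  cst : {rmorphism F -> Cfield};
  theta : Cfield;
  abs : Cfield -> R;
  abs_ge0 : forall x, 0 <= abs x;
  abs_eq0 : forall x, abs x = 0 -> x = 0;
  absM : forall x y, abs (x * y) = abs x * abs y;
  abs_ultra : forall x y, abs (x + y) <= Num.max (abs x) (abs y);
  abs_theta : abs theta = #|F|%:R;
  abs_complete : forall u : nat -> Cfield,
    abs_cauchy abs u -> exists l, abs_cvg abs u l;
  abs_dense : forall (x : Cfield) (e : R), 0 < e ->
    exists2 y, algebraic_over (laurent abs cst theta) y & abs (x - y) < e
}.

Arguments theta {R F} c.
Arguments abs {R F c} x.
Arguments cst {R F} c.

Definition abs_lim (R : realType) (F : finFieldType) (C : Cinfty R F)
  (u : nat -> C) : C := xget 0 [set l | abs_cvg abs u l].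

Section Drinfeld.
Variables (R : realType) (F : finFieldType) (C : Cinfty R F).
Variables (r : nat) (g : nat -> C).
Local Notation q := #|F|.

(* The Drinfeld module with phi_x = theta + g_1 tau + ... + g_r tau^r; the
   values of g outside 1..r are irrelevant. *)
Definition phi_x (mu : C) : C :=
  theta C * mu + \sum_(1 <= i < r.+1) g i * mu ^+ (q ^ i).

Definition phi_xn (i : nat) (mu : C) : C := iter i phi_x mu.

(* exp_coef k is the coefficient 1/D_k of mu^(q^k) in exp_phi; some of these
   may vanish.  They are determined by D_0 = 1 and
   exp_phi (theta mu) = phi_x (exp_phi mu), see exp_coef0
   and exp_coef_eq; exp_phiP shows that the series converges everywhere. *)
Fixpoint exp_coefs (k : nat) : seq C :=
  if k is k'.+1 then
    let s := exp_coefs k' in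
    rcons s ((\sum_(1 <= j < r.+1 | (j <= k)%N) g j * s`_(k - j) ^+ (q ^ j))
             / (theta C ^+ (q ^ k) - theta C))
  else [:: 1].

Definition exp_coef (k : nat) : C := (exp_coefs k)`_k.

Definition exp_phi (mu : C) : C :=
  abs_lim (fun n => \sum_(i < n) exp_coef i * mu ^+ (q ^ i)).

Definition lattice : set C := [set z | exp_phi z = 0].

(* Power series in t over C are represented by their coefficient sequences. *)
Definition omega (z : C) : nat -> C := fun k => exp_phi (z / theta C ^+ k.+1).

(* b is a polynomial in x whose coefficients are polynomials in t. *)
Definition diamond (b : {poly {poly F}}) (mu : C) : {poly C} :=
  \sum_(i < size b) phi_xn i mu *: map_poly (cst C) b`_i.

End Drinfeld.

Definition tate (R : realType) (F : finFieldType) (C : Cinfty R F)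
  (w : nat -> C) : Prop := abs (w k) @[k --> \oo] --> 0.

(* The last clause is the identity w - p = f h of power series.  Existence and
   uniqueness are remainderP and remainder_unique. *)
Definition is_remainder (R : realType) (F : finFieldType) (C : Cinfty R F)
    (f : {poly F}) (w : nat -> C) (p : {poly C}) : Prop :=
  (size p < size f)%N /\
  exists2 h : nat -> C, tate h &
    forall k, w k - p`_k = \sum_(j < k.+1) cst C f`_j * h (k - j)%N.

Definition remainder (R : realType) (F : finFieldType) (C : Cinfty R F)
  (f : {poly F}) (w : nat -> C) : {poly C} :=
  xget 0 [set p | is_remainder f w p].

Section Operators.
Variables (F : finFieldType) (f : {poly F}).
Local Notation n := (size f).-1.

(* The linear map is meant on polynomials of degree < n; monomials of degree
   >= n are sent to 0. *)
Definition Dop (p : {poly F}) : {poly F} :=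
  \sum_(i < n) p`_i *: \sum_(j < n - i) f`_(i + j + 1) *: 'X^j.

(* The outer variable is x, the inner one is t. *)
Definition O2 : {poly {poly F}} :=
  \sum_(k < n) (Dop 'X^k)^:P * ('X^k)%:P.

End Operators.

(* Consistency of the definitions: the exponential series converges, omega lies
   in the Tate algebra, and every element of it has exactly one remainder. *)
Section WellDefined.
Variables (R : realType) (F : finFieldType) (C : Cinfty R F).
Local Notation q := #|F|.
Implicit Types (u v : nat -> C) (x y l : C).

Lemma q_gt1 : (1 < q)%N.
Proof. exact: card_finNzRing_gt1. Qed.

Lemma cvg0P (a : nat -> R) : (forall n, 0 <= a n) ->
  (a n @[n --> \oo] --> 0) <->
  (forall e, 0 < e -> exists N, forall n, (N <= n)%N -> a n < e).
Proof.
move=> a0; split.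
  move=> /cvgrPdist_lt h e e0; have [N _ hN] := h _ e0.
  by exists N => n /hN /=; rewrite sub0r normrN ger0_norm.
move=> h; apply/cvgrPdist_lt => e e0; have [N hN] := h _ e0.
by exists N => // n /= /hN; rewrite sub0r normrN ger0_norm.
Qed.

Lemma abs_cvgP u l : abs_cvg abs u l <->
  (forall e, 0 < e -> exists N, forall n, (N <= n)%N -> abs (u n - l) < e).
Proof. by apply: cvg0P => n; apply: abs_ge0. Qed.

Lemma tateP u : tate u <->
  (forall e, 0 < e -> exists N, forall n, (N <= n)%N -> abs (u n) < e).
Proof. by apply: cvg0P => n; apply: abs_ge0. Qed.

Lemma abs0 : abs (0 : C) = 0.
Proof.
have : abs (0 : C) * (abs (theta C) - 1) = 0.
  by rewrite mulrBr mulr1 -absM mul0r subrr.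
move/eqP; rewrite mulf_eq0 => /orP[/eqP //|].
rewrite abs_theta subr_eq0 (eqr_nat _ _ 1) => /eqP q1.
by have := q_gt1; rewrite q1.
Qed.

Lemma abs1 : abs (1 : C) = 1.
Proof.
have : abs (1 : C) * (abs (1 : C) - 1) = 0.
  by rewrite mulrBr mulr1 -absM mul1r subrr.
move/eqP; rewrite mulf_eq0 subr_eq0 => /orP[/eqP /abs_eq0 /eqP|/eqP //].
by rewrite oner_eq0.
Qed.

Lemma absX x k : abs (x ^+ k) = abs x ^+ k.
Proof. by elim: k => [|k IH]; rewrite ?expr0 ?abs1 // !exprS absM IH. Qed.

Lemma abs_root1 x k : (0 < k)%N -> x ^+ k = 1 -> abs x = 1.
Proof.
move=> k0 /(congr1 abs); rewrite absX abs1 => /eqP.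
by rewrite pexpr_eq1 ?abs_ge0 // => /eqP.
Qed.

Lemma absN x : abs (- x) = abs x.
Proof. by rewrite -mulN1r absM (@abs_root1 (-1) 2) ?mul1r // sqrrN expr1n. Qed.

Lemma absB x y : abs (x - y) = abs (y - x).
Proof. by rewrite -absN opprB. Qed.

Lemma abs_cst (a : F) : abs (cst C a) <= 1.
Proof.
have [->|a0] := eqVneq a 0; first by rewrite rmorph0 abs0.
rewrite (@abs_root1 _ q.-1) //; first by have := q_gt1; lia.
rewrite -rmorphXn /= -[RHS](rmorph1 (cst C)); congr (cst C _).
apply: (mulfI a0); rewrite mulr1 -exprS prednK ?expf_card //.
exact: ltnW q_gt1.
Qed.

Lemma abs_add x y B : abs x <= B -> abs y <= B -> abs (x + y) <= B.
Proof. by move=> hx hy; apply: le_trans (abs_ultra x y) _; rewrite ge_max hx. Qed.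

Lemma abs_addlt x y B : abs x < B -> abs y < B -> abs (x + y) < B.
Proof. by move=> hx hy; apply: le_lt_trans (abs_ultra x y) _; rewrite gt_max hx. Qed.

Lemma abs_sum (I : Type) (s : seq I) (P : pred I) (G : I -> C) B : 0 <= B ->
  (forall i, P i -> abs (G i) <= B) -> abs (\sum_(i <- s | P i) G i) <= B.
Proof.
move=> B0 h; elim/big_ind: _ => //; first by rewrite abs0.
by move=> x y; apply: abs_add.
Qed.

Lemma abs_sumlt (I : Type) (s : seq I) (P : pred I) (G : I -> C) B : 0 < B ->
  (forall i, P i -> abs (G i) < B) -> abs (\sum_(i <- s | P i) G i) < B.
Proof.
move=> B0 h; elim/big_ind: _ => //; first by rewrite abs0.
by move=> x y; apply: abs_addlt.
Qed.

Lemma abs_le0 x : (forall e : R, 0 < e -> abs x < e) -> x = 0.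
Proof.
move=> h; apply: abs_eq0; apply/eqP; rewrite eq_le abs_ge0 andbT leNgt.
by apply/negP => /h; rewrite ltxx.
Qed.

Lemma abs_cvg_unique u l l' : abs_cvg abs u l -> abs_cvg abs u l' -> l = l'.
Proof.
move=> /abs_cvgP h /abs_cvgP h'; apply/eqP; rewrite -subr_eq0; apply/eqP.
apply: abs_le0 => e e0; have [N hN] := h _ e0; have [N' hN'] := h' _ e0.
rewrite -(subrK (u (maxn N N')) l) -addrA; apply: abs_addlt.
  by rewrite absB hN // leq_maxl.
by rewrite hN' // leq_maxr.
Qed.

Lemma abs_limE u l : abs_cvg abs u l -> abs_lim u = l.
Proof.
move=> h; apply: (abs_cvg_unique (u := u)) => //.
exact: (@xgetPex _ 0 [set l | abs_cvg abs u l] (ex_intro _ l h)).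
Qed.

Lemma abs_limP u : (exists l, abs_cvg abs u l) -> abs_cvg abs u (abs_lim u).
Proof. by move=> [l h]; rewrite (abs_limE h). Qed.

Lemma abs_cvg_le u l B : 0 <= B -> (forall n, abs (u n) <= B) ->
  abs_cvg abs u l -> abs l <= B.
Proof.
move=> B0 hu /abs_cvgP h; apply/ler_addgt0Pl => e e0; have [N hN] := h _ e0.
rewrite -(subrK (u N) l); apply: abs_add.
  by rewrite absB; apply: le_trans (ltW (hN _ (leqnn _))) _; rewrite lerDl.
by apply: le_trans (hu N) _; rewrite lerDr ltW.
Qed.

Lemma abs_cvgD u v l l' : abs_cvg abs u l -> abs_cvg abs v l' ->
  abs_cvg abs (fun n => u n + v n) (l + l').
Proof.
move=> /abs_cvgP h /abs_cvgP h'; apply/abs_cvgP => e e0.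
have [N hN] := h _ e0; have [N' hN'] := h' _ e0.
exists (maxn N N') => n; rewrite geq_max => /andP[n1 n2].
rewrite opprD addrACA; exact: abs_addlt (hN _ n1) (hN' _ n2).
Qed.

Lemma abs_cvgZ c u l : abs_cvg abs u l -> abs_cvg abs (fun n => c * u n) (c * l).
Proof.
move=> /abs_cvgP h; apply/abs_cvgP => e e0.
have c1 : 0 < abs c + 1 by have := abs_ge0 c; lra.
have [N hN] := h _ (divr_gt0 e0 c1); exists N => n /hN.
rewrite ltr_pdivlMr // => hn; rewrite -mulrBr absM; apply: le_lt_trans hn.
by rewrite mulrC ler_wpM2l ?abs_ge0 // lerDl.
Qed.

Lemma abs_cvg_sum (I : Type) (s : seq I) (U : I -> nat -> C) (L : I -> C) :
  (forall i, abs_cvg abs (U i) (L i)) ->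
  abs_cvg abs (fun n => \sum_(i <- s) U i n) (\sum_(i <- s) L i).
Proof.
move=> h; elim: s => [|i s IH].
  apply/abs_cvgP => e e0; exists 0%N => n _.
  by rewrite !big_nil subrr abs0.
have -> : (fun n => \sum_(j <- i :: s) U j n)
          = (fun n => U i n + \sum_(j <- s) U j n).
  by apply: funext => n; rewrite big_cons.
by rewrite big_cons; apply: abs_cvgD.
Qed.

Lemma abs_cvg_series u : tate u -> exists l, abs_cvg abs (fun n => \sum_(i < n) u i) l.
Proof.
move=> /tateP h; apply: abs_complete => e e0; have [N hN] := h _ e0.
have key m n : (N <= m)%N -> (m <= n)%N ->
    abs (\sum_(i < n) u i - \sum_(i < m) u i) < e.
  move=> Nm mn; rewrite -!(big_mkord xpredT) (big_cat_nat (n := m)) //=.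
  rewrite addrAC subrr add0r big_nat_cond; apply: abs_sumlt => // i.
  by case/andP => /andP[mi _] _; apply/hN/(leq_trans Nm).
exists N => m n Nm Nn; case: (leqP m n) => [mn|/ltnW nm]; last exact: key.
by rewrite absB key.
Qed.

Lemma tate_bounded u : tate u -> exists2 B, 0 < B & forall n, abs (u n) <= B.
Proof.
move=> /tateP /(_ 1 ltr01) [N hN].
exists (1 + \sum_(i < N) abs (u i)).
  by rewrite ltr_pwDl // sumr_ge0 // => i _; apply: abs_ge0.
move=> n; case: (ltnP n N) => [nN|/hN /ltW hn].
  rewrite (bigD1 (Ordinal nN)) //= addrCA lerDl addr_ge0 // sumr_ge0 // => i _.
  exact: abs_ge0.
by apply: le_trans hn _; rewrite lerDl sumr_ge0 // => i _; apply: abs_ge0.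
Qed.

Lemma remainder_unique (f : {poly F}) (w : nat -> C) (p p' : {poly C}) :
  f \is monic -> is_remainder f w p -> is_remainder f w p' -> p = p'.
Proof.
move=> fm [sp [h th hw]] [sp' [h' th' hw']].
pose d k := h' k - h k.
have dE k : (p - p')`_k = \sum_(j < k.+1) cst C f`_j * d (k - j)%N.
  rewrite coefB.
  have -> : p`_k - p'`_k = (w k - p'`_k) - (w k - p`_k) by ring.
  by rewrite hw hw' -sumrB; apply: eq_bigr => j _; rewrite -mulrBr.
have sf : (0 < size f)%N by rewrite size_poly_gt0 monic_neq0.
pose n := (size f).-1.
have fn : f`_n = 1 by have /monicP := fm; rewrite lead_coefE.
have spp : (size (p - p')%R <= n)%N.
  apply: leq_trans (size_polyD _ _) _; by rewrite size_polyN geq_max -ltnS -[X in _ && X]ltnS !prednK // sp.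
have step e k : 0 <= e -> (forall i, (k < i)%N -> abs (d i) <= e) -> abs (d k) <= e.
  move=> e0 hi.
  have := dE (n + k)%N; rewrite nth_default; last exact: leq_trans spp (leq_addr _ _).
  have ln : (n < (n + k).+1)%N by rewrite ltnS leq_addr.
  rewrite (bigD1 (Ordinal ln)) //= fn rmorph1 mul1r addKn => /eqP.
  rewrite eq_sym addr_eq0 => /eqP ->; rewrite absN; apply: abs_sum => // j jn.
  have [jl|jl] := ltnP j n.
    rewrite absM -[leRHS]mul1r; apply: ler_pM; rewrite ?abs_ge0 ?abs_cst //.
    by apply: hi; lia.
  have jn' : nat_of_ord j <> n by move=> E; move/eqP: jn; apply; apply: val_inj.
  by rewrite nth_default ?rmorph0 ?mul0r ?abs0 // -(prednK sf); lia.
have td : forall k, d k = 0.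
  move=> k; apply: abs_le0 => e e0.
  have e2 : 0 < e / 2 by lra.
  move/tateP: th => /(_ _ e2) [N hN]; move/tateP: th' => /(_ _ e2) [N' hN'].
  suff H m i : (N + N' <= i + m)%N -> abs (d i) <= e / 2.
    by apply: le_lt_trans (H (N + N')%N k _) _; [lia|lra].
  elim: m i => [|m IH] i hi.
    apply/ltW/abs_addlt; [apply: hN'; lia|rewrite absN; apply: hN; lia].
  by apply: step; [lra|move=> j ij; apply: IH; lia].
apply/eqP; rewrite -subr_eq0; apply/eqP/polyP => k.
by rewrite dE coef0 big1 // => j _; rewrite td mulr0.
Qed.

Lemma remainder_exists (f : {poly F}) (w : nat -> C) :
  f \is monic -> (1 < size f)%N -> tate w -> exists p, is_remainder f w p.
Proof.
move=> fm sf tw.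
pose Q m : {poly F} := 'X^m %/ f; pose M m : {poly F} := 'X^m %% f.
have null (a : nat -> F) : tate (fun m => w m * cst C (a m)).
  apply/tateP => e e0; move/tateP: tw => /(_ _ e0) [N hN].
  exists N => m /hN; apply: le_lt_trans; rewrite absM -[leRHS]mulr1.
  by rewrite ler_wpM2l ?abs_ge0 ?abs_cst.
pose h j := abs_lim (fun N => \sum_(m < N) w m * cst C (Q m)`_j).
pose rho j := abs_lim (fun N => \sum_(m < N) w m * cst C (M m)`_j).
have hP j : abs_cvg abs (fun N => \sum_(m < N) w m * cst C (Q m)`_j) (h j).
  exact: abs_limP (abs_cvg_series (null (fun m => (Q m)`_j))).
have rhoP j : abs_cvg abs (fun N => \sum_(m < N) w m * cst C (M m)`_j) (rho j).
  exact: abs_limP (abs_cvg_series (null (fun m => (M m)`_j))).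
have szQ m : (size (Q m) <= m)%N.
  by rewrite /Q size_divp ?monic_neq0 // size_polyXn leq_subLR -add1n leq_add2r ltn_predRL.
have f0 : f != 0 by apply: monic_neq0.
have rho0 j : (size f <= j.+1)%N -> rho j = 0.
  move=> fj; apply: abs_cvg_unique (rhoP j) _; apply/abs_cvgP => e e0.
  exists 0%N => N _; rewrite subr0 big1 ?abs0 // => m _.
  rewrite [_`_j]nth_default ?rmorph0 ?mulr0 //.
  by rewrite -ltnS; apply: leq_trans _ fj; rewrite ltn_modp.
have prho k : (\poly_(i < (size f).-1) rho i)`_k = rho k.
  rewrite coef_poly; case: ltnP => // hk; by rewrite rho0 //; move: hk; rewrite -ltnS prednK // ltnW.
exists (\poly_(i < (size f).-1) rho i); split.
  by apply: leq_ltn_trans (size_poly _ _) _; rewrite ltn_predL ltnW.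
exists h.
  apply/tateP => e e0; move/tateP: tw => /(_ (e / 2)) [|N hN]; first by lra.
  exists N => n Nn; suff : abs (h n) <= e / 2 by lra.
  apply: abs_cvg_le (hP n) => [|K]; first by lra.
  apply: abs_sum => [|m _]; first by lra.
  have [mn|nm] := leqP m n.
    rewrite [_`_n]nth_default ?(leq_trans (szQ m)) //.
    by rewrite rmorph0 mulr0 abs0; lra.
  rewrite absM -[leRHS]mulr1; apply: ler_pM; rewrite ?abs_ge0 ?abs_cst //.
  by apply/ltW/hN; lia.
move=> k; rewrite prho; apply/eqP; rewrite subr_eq; apply/eqP.
have H : abs_cvg abs (fun N => \sum_(j < k.+1) cst C f`_j *
      (\sum_(m < N) w m * cst C (Q m)`_(k - j)) + \sum_(m < N) w m * cst C (M m)`_k)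
    (\sum_(j < k.+1) cst C f`_j * h (k - j)%N + rho k).
  apply: abs_cvgD (rhoP k); apply: abs_cvg_sum => j.
  exact: abs_cvgZ.
apply: abs_cvg_unique H; apply/abs_cvgP => e e0; exists k.+1 => N kN.
suff -> : \sum_(j < k.+1) cst C f`_j * (\sum_(m < N) w m * cst C (Q m)`_(k - j))
    + \sum_(m < N) w m * cst C (M m)`_k = w k by rewrite subrr abs0.
under eq_bigr do rewrite big_distrr /=.
rewrite exchange_big /= -big_split /=.
under eq_bigr => m _.
  under eq_bigr do rewrite mulrCA -rmorphM /=.
  rewrite -big_distrr /= -mulrDr -rmorph_sum -rmorphD /= -coefM -coefD.
  rewrite [f * _]mulrC -divp_eq coefXn; over.
rewrite (bigD1 (Ordinal kN)) //= eqxx rmorph1 mulr1 big1 ?addr0 // => i ik.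
have -> : (k == i) = false.
  by apply: contraNF ik => /eqP E; apply/eqP/val_inj.
by rewrite rmorph0 mulr0.
Qed.

Lemma remainderP (f : {poly F}) (w : nat -> C) :
  f \is monic -> (1 < size f)%N -> tate w -> is_remainder f w (remainder f w).
Proof.
move=> fm sf tw; have h := remainder_exists fm sf tw.
exact: (@xgetPex _ 0 [set p | is_remainder f w p] h).
Qed.

Section Exp.
Variables (r : nat) (g : nat -> C).

Lemma size_exp_coefs k : size (exp_coefs r g k) = k.+1.
Proof. by elim: k => //= k IH; rewrite size_rcons IH. Qed.

Lemma nth_exp_coefs k i : (i <= k)%N -> (exp_coefs r g k)`_i = exp_coef r g i.
Proof.
elim: k => [|k IH]; first by rewrite leqn0 => /eqP ->.
rewrite leq_eqVlt => /orP[/eqP -> //|ik] /=.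
by rewrite nth_rcons size_exp_coefs ik IH.
Qed.

Lemma abs_theta_sub k : (0 < k)%N ->
  abs (theta C ^+ (q ^ k) - theta C) = q%:R ^+ (q ^ k).
Proof.
move=> k0; have q1 := q_gt1; have qk : (1 < q ^ k)%N by rewrite -[1%N](expn0 q) ltn_exp2l.
have lt : abs (theta C) < abs (theta C ^+ (q ^ k)).
  by rewrite absX abs_theta ltr_eXnr // ltr1n.
rewrite -(abs_theta C) -absX; apply/eqP; rewrite eq_le; apply/andP; split.
  by apply: abs_add => //; rewrite absN ltW.
have := abs_ultra (theta C ^+ (q ^ k) - theta C) (theta C).
by rewrite subrK le_max [X in _ || X]leNgt lt orbF.
Qed.

Lemma exp_coef0 : exp_coef r g 0 = 1.
Proof. by []. Qed.

Lemma exp_coef_rec k : (0 < k)%N -> exp_coef r g k =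
  (\sum_(1 <= j < r.+1 | (j <= k)%N) g j * exp_coef r g (k - j) ^+ (q ^ j))
   / (theta C ^+ (q ^ k) - theta C).
Proof.
case: k => // k _; rewrite /exp_coef /= nth_rcons size_exp_coefs ltnn eqxx.
congr (_ / _); rewrite big_nat_cond [RHS]big_nat_cond; apply: eq_bigr => j.
by move=> /andP[/andP[j1 _] jk]; rewrite nth_exp_coefs //; lia.
Qed.

(* Comparison of the coefficients of mu^(q^k) in
   exp_phi (theta mu) = phi_x (exp_phi mu). *)
Lemma exp_coef_eq k : exp_coef r g k * theta C ^+ (q ^ k) =
  theta C * exp_coef r g k +
  \sum_(1 <= j < r.+1 | (j <= k)%N) g j * exp_coef r g (k - j) ^+ (q ^ j).
Proof.
case: (posnP k) => [->|k0].
  rewrite exp_coef0 expn0 expr1 mul1r mulr1 big_nat_cond big1 ?addr0 // => j.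
  by move=> /andP[/andP[j1 _] j0]; lia.
apply/eqP; rewrite addrC -subr_eq [theta C * _]mulrC -mulrBr exp_coef_rec // divfK //.
apply/eqP => /(congr1 abs); rewrite abs_theta_sub // abs0 => /eqP.
rewrite expf_eq0 pnatr_eq0 => /andP[_ /eqP q0].
by have := q_gt1; rewrite q0.
Qed.

Lemma exp_terms_null (mu : C) : tate (fun i => exp_coef r g i * mu ^+ (q ^ i)).
Proof.
pose b i := abs (exp_coef r g i * mu ^+ (q ^ i)).
have b0 i : 0 <= b i by apply: abs_ge0.
pose Q : R := q%:R; have Q2 : 2 <= Q by rewrite ler_nat q_gt1.
have [G G1 hG] : exists2 G : R, 1 <= G & forall j, (0 < j <= r)%N -> abs (g j) <= G.
  exists (1 + \sum_(j < r.+1) abs (g j)).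
    by rewrite lerDl sumr_ge0 // => i _; apply: abs_ge0.
  move=> j /andP[_ jr]; have jr' : (j < r.+1)%N by lia.
  rewrite (bigD1 (Ordinal jr')) //= addrCA lerDl addr_ge0 // sumr_ge0 // => i _.
  exact: abs_ge0.
have brec k (A : R) : (0 < k)%N -> 0 <= A ->
    (forall j, (0 < j <= r)%N -> (j <= k)%N -> b (k - j)%N <= A ^+ (q ^ (k - j))) ->
    b k <= G * (A / Q) ^+ (q ^ k).
  move=> k0 A0 hA; rewrite /b exp_coef_rec // mulrAC absM.
  have Qk : 0 < Q ^+ (q ^ k) by rewrite exprn_gt0 //; lra.
  have -> : abs (theta C ^+ (q ^ k) - theta C)^-1 = (Q ^+ (q ^ k))^-1.
    apply: (mulfI (lt0r_neq0 Qk)); rewrite divff ?lt0r_neq0 //.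
    rewrite -{1}(abs_theta_sub k0) -absM divff ?abs1 //.
    apply/eqP => /(congr1 abs); rewrite abs_theta_sub // abs0.
    by apply/eqP/lt0r_neq0.
  rewrite expr_div_n mulrA ler_pM2r ?invr_gt0 // big_distrl /=.
  rewrite big_nat_cond; apply: abs_sum => [|j].
    by rewrite mulr_ge0 ?exprn_ge0 //; lra.
  move=> /andP[/andP[j1 jr] jk]; rewrite -mulrA absM.
  apply: ler_pM; rewrite ?abs_ge0 ?hG //; first by lia.
  have E : (q ^ k = q ^ (k - j) * q ^ j)%N by rewrite -expnD subnK.
  rewrite E !exprM -exprMn absX; apply: lerXn2r; rewrite ?nnegrE ?abs_ge0 ?exprn_ge0 //.
  by apply: hA => //; lia.
have qk k : (k < q ^ k)%N by apply: ltn_expl q_gt1.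
have bern (x : R) : 1 < x -> forall B : R, exists N, forall k, (N <= k)%N -> B <= x ^+ (q ^ k).
  move=> x1 B.
  have : (x^-1) ^+ n @[n --> \oo] --> 0.
    by apply: cvg_expr; rewrite ger0_norm ?invr_ge0 ?invf_lt1 //; lra.
  have xx n : 0 <= x^-1 ^+ n by rewrite exprn_ge0 // invr_ge0; lra.
  move=> /(cvg0P xx) /(_ (`|B| + 1)^-1) [|N hN].
    by rewrite invr_gt0; have := normr_ge0 B; lra.
  exists N => k Nk; have /hN : (N <= q ^ k)%N by have := qk k; lia.
  have xk : 0 < x ^+ (q ^ k) by rewrite exprn_gt0 //; lra.
  rewrite exprVn ltf_pV2 ?posrE //; last by have := normr_ge0 B; lra.
  by have := ler_norm B; lra.
have [N0 hN0] := bern (3%:R / 2%:R) ltac:(lra) G.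
have [A A1 hA] : exists2 A : R, 1 <= A & forall k, (k <= N0)%N -> b k <= A.
  exists (1 + \sum_(j < N0.+1) b j); first by rewrite lerDl sumr_ge0.
  move=> k kN; have kN' : (k < N0.+1)%N by lia.
  by rewrite (bigD1 (Ordinal kN')) //= addrCA lerDl addr_ge0 // sumr_ge0.
pose c : R := 3%:R / 4%:R.
have main m : exists N, forall k, (N <= k)%N -> b k <= (A * c ^+ m) ^+ (q ^ k).
  have gen k (B : R) : 0 <= B -> (N0 <= k)%N -> (0 < k)%N ->
      (forall j, (0 < j <= r)%N -> (j <= k)%N -> b (k - j)%N <= B ^+ (q ^ (k - j))) ->
      b k <= (B * c) ^+ (q ^ k).
    move=> B0 Nk k0 hB; apply: le_trans (brec _ _ k0 B0 hB) _.
    apply: le_trans (_ : (3%:R / 2%:R) ^+ (q ^ k) * (B / Q) ^+ (q ^ k) <= _).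
      by rewrite ler_wpM2r ?hN0 // exprn_ge0 // divr_ge0 //; lra.
    rewrite -exprMn; apply: lerXn2r; rewrite ?nnegrE.
    - by rewrite mulr_ge0 ?divr_ge0 //; lra.
    - by rewrite mulr_ge0 // /c; lra.
    rewrite mulrCA ler_wpM2l // ler_pdivrMr /c; lra.
  elim: m => [|m [N hN]].
    exists 0%N => k _; rewrite expr0 mulr1.
    elim/ltn_ind: k => k IH; have [kN|Nk] := leqP k N0.
      apply: le_trans (hA _ kN) _; rewrite -[leLHS]expr1.
      by rewrite ler_weXn2l // expn_gt0; have := q_gt1; lia.
    apply: le_trans (gen k A _ _ _ _) _ => [||||]; [lra|lia|lia| |].
      by move=> j /andP[j0 _] jk; apply: IH; lia.
    apply: lerXn2r; rewrite ?nnegrE /c; [nra|lra|nra].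
  exists (N + N0 + r).+1 => k hk; rewrite exprSr mulrA; apply: gen; [|lia|lia|].
    by rewrite mulr_ge0 ?exprn_ge0 // /c; lra.
  by move=> j jr jk; apply: hN; lia.
have cn0 : c ^+ n @[n --> \oo] --> 0.
  by apply: cvg_expr; rewrite ger0_norm /c; lra.
have cge n : 0 <= c ^+ n by rewrite exprn_ge0 // /c; lra.
have [|m hm] := (cvg0P cge).1 cn0 (2%:R * A)^-1; first by rewrite invr_gt0; lra.
have {}hm : A * c ^+ m <= 2%:R^-1.
  have := ltW (hm _ (leqnn _)); rewrite invfM ler_pdivlMr; last by lra.
  by rewrite mulrC.
have [N hN] := main m; apply/tateP => e e0.
have [N' hN'] := bern 2 ltac:(lra) (e^-1 + 1).
exists (N + N')%N => k hk.
have := hN k ltac:(lia); have := hN' k ltac:(lia).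
rewrite -/(b k); set n := (q ^ k)%N => h2 h1.
have h3 : (A * c ^+ m) ^+ n <= (2 ^+ n)^-1.
  rewrite -exprVn; apply: lerXn2r; rewrite ?nnegrE ?mulr_ge0 ?invr_ge0 //; lra.
apply: le_lt_trans (le_trans h1 h3) _.
rewrite -[ltRHS]invrK ltf_pV2 ?posrE ?invr_gt0 ?exprn_gt0 //; lra.
Qed.

Lemma exp_phiP (mu : C) :
  abs_cvg abs (fun n => \sum_(i < n) exp_coef r g i * mu ^+ (q ^ i))
    (exp_phi r g mu).
Proof. exact: abs_limP (abs_cvg_series (exp_terms_null _)). Qed.

Lemma omega_tate (z : C) : tate (omega r g z).
Proof.
have := exp_terms_null 1; move=> /tate_bounded[B B0 hB1].
have hB i : abs (exp_coef r g i) <= B by have := hB1 i; rewrite expr1n mulr1.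
have small (x : C) : abs x <= 1 -> abs (exp_phi r g x) <= B * abs x.
  move=> x1; apply: abs_cvg_le (exp_phiP x) => [|n].
    by rewrite mulr_ge0 ?abs_ge0 // ltW.
  apply: abs_sum => [|i _]; first by rewrite mulr_ge0 ?abs_ge0 // ltW.
  rewrite absM; apply: ler_pM; rewrite ?abs_ge0 // absX.
  by rewrite -[leRHS]expr1 ler_wiXn2l ?abs_ge0 // expn_gt0 (ltnW q_gt1).
pose Q : R := q%:R; have Q2 : 2 <= Q by rewrite ler_nat q_gt1.
have th k : abs (z / theta C ^+ k) = abs z * Q^-1 ^+ k.
  have Qk : Q ^+ k != 0 by rewrite expf_neq0 //; lra.
  have tk : theta C ^+ k != 0.
    by apply/eqP => /(congr1 abs); rewrite absX abs_theta abs0; apply/eqP.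
  apply: (mulIf Qk); rewrite exprVn divfK // -[Q](abs_theta C) -absX -absM divfK //.
have Qn n : 0 <= Q^-1 ^+ n by rewrite exprn_ge0 // invr_ge0; lra.
have Q0 : Q^-1 ^+ n @[n --> \oo] --> 0.
  by apply: cvg_expr; rewrite ger0_norm ?invr_ge0 ?invf_lt1 //; lra.
have a0 := abs_ge0 z.
apply/tateP => e e0.
pose e' := Num.min 1 (e / B) / (abs z + 1).
have z1 : 0 < abs z + 1 by lra.
have e'0 : 0 < e' by rewrite divr_gt0 // lt_min ltr01 divr_gt0.
have [N hN] := (cvg0P Qn).1 Q0 _ e'0.
exists N => k Nk; rewrite /omega.
have : abs (z / theta C ^+ k.+1) < Num.min 1 (e / B).
  rewrite th; have := hN k.+1 ltac:(lia); rewrite ltr_pdivlMr // mulrDr mulr1 mulrC.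
  by apply: le_lt_trans; rewrite lerDl.
rewrite lt_min => /andP[h1 h2]; apply: le_lt_trans (small _ (ltW h1)) _.
by rewrite mulrC -ltr_pdivlMr.
Qed.

End Exp.
End WellDefined.

(* Main.v *)
(* Since z is a period, exp_phi (theta mu) = phi_x (exp_phi mu) says that
   applying phi_x to the coefficients of omega_z is multiplication by t.  As
   phi_x is continuous and F-linear, it commutes with taking f-remainders, so
   the remainder p of omega_z satisfies phi_x(p) = t p - C f, where C is the
   coefficient of t^(n-1) in p.  Comparing coefficients gives
   p_i = phi_x(p_(i+1)) + a_(i+1) C, which, solved downwards from
   p_(n-1) = C, is the asserted formula. *)
Require Import Defs.
From mathcomp Require Import all_boot all_order all_algebra.
From mathcomp Require Import boolp classical_sets reals topology normedtype sequences.
From mathcomp Require Import finfield zify.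
From HB Require Import structures.

Import Order.TTheory GRing.Theory Num.Theory.

Local Open Scope ring_scope.

(** * Limits and Frobenius powers in [C] *)

Section Convergence.
Context {R : realType} {F : finFieldType} {C : Cinfty R F}.
Local Notation q := #|F|.
Implicit Types (u v : nat -> C) (x y l : C).

Lemma tate_cvg0 u : tate u <-> abs_cvg abs u 0.
Proof.
by split=> [/tateP h|/abs_cvgP h]; [apply/abs_cvgP|apply/tateP] => e /h [N hN];
  exists N => k /hN; rewrite subr0.
Qed.

Lemma abs_cvg_shift j u l : abs_cvg abs u l ->
  abs_cvg abs (fun k => u (k - j)%N) l.
Proof.
move=> /abs_cvgP h; apply/abs_cvgP => e /h [N hN].
by exists (N + j)%N => k Nk; apply: hN; lia.
Qed.

(** In terms of power series, this is the passage from $u$ to $tu+c$. *)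
Lemma tate_cons (c : C) u :
  tate u -> tate (fun k => if k is k'.+1 then u k' else c).
Proof.
move=> /tateP h; apply/tateP => e /h [N hN].
by exists N.+1 => -[//|k] /hN.
Qed.

(** The morphism [cst] gives [C] the characteristic of [F], of which $q$ is a power. This is the
    form that makes $q^j$-th powers additive. *)
Lemma card_expn_pnat j : [pchar C].-nat (q ^ j)%N.
Proof.
have [p p_pr pF] := finPcharP F.
rewrite (card_pprimeChar pF) !pnatX pnatE //.
by rewrite (rmorph_pchar (cst C)).
Qed.

Lemma frobeniusD j x y : (x + y) ^+ (q ^ j) = x ^+ (q ^ j) + y ^+ (q ^ j).
Proof. by rewrite exprDn_pchar ?card_expn_pnat. Qed.

Lemma frobenius0 j : (0 : C) ^+ (q ^ j) = 0.
Proof. by rewrite expr0n expn_eq0 -leqn0 leqNgt (ltnW (q_gt1 F)). Qed.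

Lemma frobenius_sum j (I : Type) (s : seq I) (G : I -> C) :
  (\sum_(i <- s) G i) ^+ (q ^ j) = \sum_(i <- s) G i ^+ (q ^ j).
Proof. exact: (big_morph _ (frobeniusD j) (frobenius0 j)). Qed.

Lemma cst_frobenius j (a : F) : cst C a ^+ (q ^ j) = cst C a.
Proof.
rewrite -rmorphXn /=; congr (cst C _).
by elim: j => [|j IH]; rewrite ?expn0 ?expr1 // expnSr exprM IH expf_card.
Qed.

Lemma abs_cvg_frobenius j u l : abs_cvg abs u l ->
  abs_cvg abs (fun k => u k ^+ (q ^ j)) (l ^+ (q ^ j)).
Proof.
move=> /abs_cvgP h; apply/abs_cvgP => e e0.
(* By additivity the error becomes $(u_k-l)^{q^j}$, and the bound 1 ensures that raising to this
   power does not enlarge it. *)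
have [|N hN] := h (Num.min 1 e); first by rewrite lt_min ltr01.
exists N => k /hN; rewrite lt_min => /andP[h1 he].
rewrite -[u k](subrK l) frobeniusD addrK absX.
apply: le_lt_trans he; rewrite -[leRHS]expr1.
by rewrite ler_wiXn2l ?abs_ge0 ?(ltW h1) // expn_gt0 (ltnW (q_gt1 F)).
Qed.

End Convergence.

(** * The functional equation of the exponential and its effect on $\omega_z$ *)

Section Drinfeld.
Context {R : realType} {F : finFieldType} {C : Cinfty R F}.
Variables (r : nat) (g : nat -> C).
Local Notation q := #|F|.

Lemma phi_x_is_zmod_morphism : zmod_morphism (phi_x r g).
Proof.
have phiD x y : phi_x r g (x + y) = phi_x r g x + phi_x r g y.
  rewrite /phi_x mulrDr addrACA; congr (_ + _); rewrite -big_split /=.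
  by apply: eq_bigr => j _; rewrite frobeniusD mulrDr.
by move=> x y; apply: (canRL (addrK _)); rewrite -phiD subrK.
Qed.

HB.instance Definition _ :=
  GRing.isZmodMorphism.Build C C (phi_x r g) phi_x_is_zmod_morphism.

Lemma phi_xZ (a : F) (y : C) : phi_x r g (cst C a * y) = cst C a * phi_x r g y.
Proof.
rewrite /phi_x mulrDr mulrCA; congr (_ + _); rewrite big_distrr /=.
by apply: eq_bigr => j _; rewrite exprMn cst_frobenius mulrCA.
Qed.

Lemma abs_cvg_phi_x (u : nat -> C) (l : C) : abs_cvg abs u l ->
  abs_cvg abs (fun k => phi_x r g (u k)) (phi_x r g l).
Proof.
move=> h; apply: abs_cvgD; first exact: abs_cvgZ.
by apply: abs_cvg_sum => j; apply: abs_cvgZ; apply: abs_cvg_frobenius.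
Qed.

(** The recursion for the $1/D_k$ gives an exact identity between partial sums,
    $S_k(\theta\mu)=\theta S_k(\mu)+\sum_j g_j S_{k-j}(\mu)^{q^j}$; the limit in $k$ follows by
    continuity. *)
Lemma exp_phi_functional (mu : C) :
  exp_phi r g (theta C * mu) = phi_x r g (exp_phi r g mu).
Proof.
pose S k := \sum_(i < k) exp_coef r g i * mu ^+ (q ^ i).
have hS : abs_cvg abs S (exp_phi r g mu) by apply: exp_phiP.
apply: (abs_cvg_unique (exp_phiP r g (theta C * mu))).
have -> : (fun k => \sum_(i < k) exp_coef r g i * (theta C * mu) ^+ (q ^ i)) =
    (fun k => theta C * S k
       + \sum_(1 <= j < r.+1) g j * S (k - j)%N ^+ (q ^ j)).
  apply: funext => k; under eq_bigr do
    rewrite exprMn mulrA exp_coef_eq mulrDl -mulrA.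
  rewrite big_split -big_distrr /=; congr (_ + _).
  under eq_bigr do rewrite big_distrl /= big_mkcond.
  rewrite exchange_big /=; apply: eq_bigr => j _.
  rewrite frobenius_sum big_distrr /= -big_mkcond /=.
  (* For $k<j$ truncated subtraction gives the empty sum $S_0$, and no index $i<k$ satisfies $j\le
     i$. Otherwise the index is shifted by $j$. *)
  have [jk|kj] := leqP j k; last first.
    have -> : (k - j = 0)%N by lia.
    by rewrite big_ord0 big1 // => i ji; have := ltn_ord i; lia.
  rewrite -(big_mkord (fun i => j <= i)%N
    (fun i => g j * exp_coef r g (i - j) ^+ (q ^ j) * mu ^+ (q ^ i))).
  rewrite (big_cat_nat (n := j)) //= big_nat_cond big1 ?add0r; last first.
    by move=> i; lia.
  rewrite -{1}[j]add0n big_addn big_mkord.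
  apply: eq_big => [i|i _]; first by rewrite leq_addl.
  by rewrite addnK exprMn -exprM -expnD mulrA.
apply: abs_cvgD; first exact: abs_cvgZ.
apply: abs_cvg_sum => j; apply: abs_cvgZ; apply: abs_cvg_frobenius.
exact: abs_cvg_shift.
Qed.

Lemma phi_x_omega (z : C) (k : nat) : lattice r g z ->
  phi_x r g (omega r g z k) = if k is k'.+1 then omega r g z k' else 0.
Proof.
have t0 : theta C != 0.
  apply/eqP => /(congr1 abs); rewrite abs_theta abs0 => /eqP.
  by rewrite pnatr_eq0 -leqn0 leqNgt (ltnW (q_gt1 F)).
move=> hz; rewrite -exp_phi_functional.
(* Only the constant coefficient uses that $z$ is a period: there $\theta\cdot z/\theta=z$. *)
case: k => [|k]; first by rewrite mulrCA expr1 divff ?mulr1.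
by rewrite exprS invfM mulrCA mulVKf.
Qed.

(** * Remainders under [phi_x] and under multiplication by $t$ *)

Section Remainders.
Context {n : nat} {f : {poly F}}.
Hypotheses (fmonic : f \is monic) (fdeg : size f = n.+1).

(** Apply [phi_x] coefficientwise to $w-p=\mathfrak{f}h$: it passes through $\mathfrak{f}$, whose
    coefficients lie in [F], and continuity at 0 keeps the image of $h$ in the Tate algebra. *)
Lemma is_remainder_phi_x (w : nat -> C) (p : {poly C}) :
  is_remainder f w p ->
  is_remainder f (fun k => phi_x r g (w k)) (\poly_(i < n) phi_x r g p`_i).
Proof.
move=> [sp [h th hw]]; split; first by rewrite fdeg ltnS size_poly.
exists (fun k => phi_x r g (h k)).
  apply/tate_cvg0; rewrite -(raddf0 (phi_x r g)).
  exact: abs_cvg_phi_x (proj1 (tate_cvg0 _) th).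
have pE k : (\poly_(i < n) phi_x r g p`_i)`_k = phi_x r g p`_k.
  rewrite coef_poly; case: ltnP => // nk.
  by rewrite nth_default ?raddf0 // (leq_trans _ nk) // -ltnS -fdeg.
move=> k; rewrite pE -raddfB hw raddf_sum.
by apply: eq_bigr => j _; rewrite /= phi_xZ.
Qed.

(** With $c=p_{n-1}$, the equality $w-p=\mathfrak{f}h$ gives
    $tw-(tp-c\mathfrak{f})=\mathfrak{f}(th+c)$. As $\mathfrak{f}$ is monic, subtracting
    $c\mathfrak{f}$ removes the term in $t^n$. *)
Lemma is_remainder_mulX (w : nat -> C) (p : {poly C}) : (0 < n)%N ->
  is_remainder f w p ->
  is_remainder f (fun k => if k is k'.+1 then w k' else 0)
    (p * 'X - p`_n.-1 *: map_poly (cst C) f).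
Proof.
move=> n0 [+ [h th hw]]; rewrite fdeg ltnS => sp.
have fn : f`_n = 1 by have /monicP := fmonic; rewrite lead_coefE fdeg.
have coefE k : (p * 'X - p`_n.-1 *: map_poly (cst C) f)`_k =
    (if k is k'.+1 then p`_k' else 0) - p`_n.-1 * cst C f`_k.
  by rewrite coefB coefMX coefZ coef_map; case: k.
split.
  rewrite fdeg ltnS; apply/leq_sizeP => k; rewrite coefE leq_eqVlt.
  case/predU1P=> [<-|nk].
    by rewrite fn rmorph1 mulr1; case: n n0 => //= m _; rewrite subrr.
  rewrite [f`_k]nth_default ?fdeg // rmorph0 mulr0 subr0.
  by case: k nk => // k nk; rewrite nth_default // (leq_trans sp).
exists (fun k => if k is k'.+1 then h k' else p`_n.-1); first exact: tate_cons.
move=> [|k]; rewrite coefE.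
  by rewrite big_ord1 sub0r opprB subr0 mulrC.
rewrite opprD opprK addrA hw [RHS]big_ord_recr /= subnn [p`_n.-1 * _]mulrC.
by congr (_ + _); apply: eq_bigr => j _; rewrite subSn // -ltnS.
Qed.

End Remainders.

(** * Linearity of the Drinfeld action and its values on the
    $\operatorname{D}_{\mathfrak{f}}(x^i)$ *)

Lemma diamond_widen (b : {poly {poly F}}) (mu : C) (m : nat) :
  (size b <= m)%N ->
  diamond r g b mu = \sum_(i < m) phi_xn r g i mu *: map_poly (cst C) b`_i.
Proof.
move=> bm; rewrite /diamond (big_ord_widen _ (fun i =>
  phi_xn r g i mu *: map_poly (cst C) b`_i) bm) big_mkcond /=.
apply: eq_bigr => i _; case: ltnP => // bi.
by rewrite [b`_i]nth_default // rmorph0 scaler0.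
Qed.

Lemma diamond_sum (I : Type) (s : seq I) (b : I -> {poly {poly F}}) (mu : C) :
  diamond r g (\sum_(i <- s) b i) mu = \sum_(i <- s) diamond r g (b i) mu.
Proof.
have diamond0 : diamond r g 0 mu = 0 by rewrite /diamond size_poly0 big_ord0.
have diamondD b1 b2 :
    diamond r g (b1 + b2) mu = diamond r g b1 mu + diamond r g b2 mu.
  pose m := (size (b1 + b2)%R + size b1 + size b2)%N.
  rewrite !(diamond_widen _ _ m) ?/m; try lia.
  by rewrite -big_split; apply: eq_bigr => i _; rewrite coefD rmorphD scalerDr.
exact: (big_morph (fun b => diamond r g b mu) diamondD diamond0).
Qed.

Lemma diamond_mulC (b : {poly {poly F}}) (c : {poly F}) (mu : C) :
  diamond r g (b * c%:P) mu = diamond r g b mu * map_poly (cst C) c.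
Proof.
pose m := (size (b * c%:P)%R + size b)%N.
rewrite !(diamond_widen _ _ m) ?/m; try lia.
rewrite big_distrl; apply: eq_bigr => i _.
by rewrite coefMC rmorphM /= scalerAl.
Qed.

End Drinfeld.

Lemma DopXn (F : finFieldType) (f : {poly F}) (i : nat) :
  (i < (size f).-1)%N ->
  Dop f 'X^i = \poly_(j < (size f).-1 - i) f`_(i + j + 1).
Proof.
move=> ni; rewrite /Dop (bigD1 (Ordinal ni)) //= coefXn eqxx scale1r poly_def.
rewrite [X in _ + X]big1 ?addr0 // => k /eqP ki; rewrite coefXn.
case: eqP => [E|_]; last by rewrite scale0r.
by case: ki; apply: val_inj.
Qed.

(** [^:P] makes the coefficients constant in $t$, so the action yields a constant, to be matched
    with the coefficient of $t^i$ in the remainder. *)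
Lemma diamond_DopXn {R : realType} {F : finFieldType} {C : Cinfty R F}
    (r : nat) (g : nat -> C) (f : {poly F}) (i : nat) (mu : C) :
  (i < (size f).-1)%N ->
  diamond r g (Dop f 'X^i)^:P mu =
    (\sum_(j < (size f).-1 - i) cst C f`_(i + j + 1) * phi_xn r g j mu)%:P.
Proof.
move=> ni; rewrite (diamond_widen _ _ _ _ ((size f).-1 - i)); last first.
  by rewrite size_map_polyC DopXn // size_poly.
rewrite [RHS]rmorph_sum /=; apply: eq_bigr => j _.
rewrite coef_map DopXn // coef_poly ltn_ord map_polyC -mul_polyC /=.
by rewrite -rmorphM mulrC.
Qed.

Theorem theorem4p5 (R : realType) (F : finFieldType) (C : Cinfty R F)
    (r : nat) (g : nat -> C) (hr : (1 <= r)%N) (hg : g r != 0)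
    (n : nat) (f : {poly F}) (hn : (1 <= n)%N)
    (fmonic : f \is monic) (fdeg : size f = n.+1)
    (z : C) (hz : lattice r g z) :
  let rem := remainder f (omega r g z) in
  let Cz := rem`_(n.-1) in
  rem = diamond r g (O2 f) Cz /\
  diamond r g (O2 f) Cz
    = \sum_(i < n) diamond r g ((Dop f 'X^i)^:P) Cz * 'X^i.
Proof.
move=> p Cz.
have O2E : diamond r g (O2 f) Cz
    = \sum_(i < n) diamond r g ((Dop f 'X^i)^:P) Cz * 'X^i.
  rewrite /O2 fdeg diamond_sum; apply: eq_bigr => i _.
  by rewrite diamond_mulC map_polyXn.
split=> //; rewrite {}O2E.
have hp : is_remainder f (omega r g z) p.
  by apply: remainderP; rewrite ?fdeg //; apply: omega_tate.
have sp : (size p <= n)%N by case: hp; rewrite fdeg.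
(* Both sides are remainders of $t\,\omega_z$. *)
have phi_p : \poly_(i < n) phi_x r g p`_i = p * 'X - Cz *: map_poly (cst C) f.
  apply: (remainder_unique fmonic (is_remainder_phi_x r g fdeg _ _ hp)).
  have := is_remainder_mulX fmonic fdeg _ _ hn hp.
  by congr is_remainder; apply: funext => k; rewrite phi_x_omega.
have rec i : (i.+1 < n)%N -> p`_i = phi_x r g p`_i.+1 + cst C f`_i.+1 * Cz.
  move=> ni; have := congr1 (fun s : {poly C} => s`_i.+1) phi_p.
  rewrite coef_poly ni coefB coefMX coefZ coef_map /= => ->.
  by rewrite mulrC subrK.
(* Here $m$ is the distance from the top coefficient; the case $m=0$ reads $p_{n-1}=a_nC$ with
   $a_n=1$. *)
have pE m : (m < n)%N -> p`_(n.-1 - m) =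
    \sum_(j < m.+1) cst C f`_(n.-1 - m + j + 1) * phi_xn r g j Cz.
  elim: m => [|m IH] mn.
    rewrite subn0 big_ord1 addn0 addn1 prednK //.
    by have /monicP := fmonic; rewrite lead_coefE fdeg => ->; rewrite rmorph1 mul1r.
  rewrite rec; last by lia.
  have E : ((n.-1 - m.+1).+1 = n.-1 - m)%N by lia.
  (* The term $j=0$ is the new summand $a_{i+1}C$; [phi_x] turns each old term of index $j$ into the
     one of index $j+1$. *)
  rewrite E IH ?(ltnW mn) // raddf_sum [RHS]big_ord_recl addrC.
  congr (_ + _); first by rewrite addn0 addn1 E.
  apply: eq_bigr => j _; rewrite /= phi_xZ /bump /= add1n.
  by congr (cst C f`_ _ * _); lia.
have -> : p = \sum_(i < n) (p`_i)%:P * 'X^i.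
  under eq_bigr do rewrite mul_polyC.
  rewrite -poly_def; apply/polyP => k; rewrite coef_poly.
  by case: ltnP => // nk; rewrite nth_default // (leq_trans sp).
apply: eq_bigr => i _; rewrite diamond_DopXn fdeg //; congr (_%:P * _).
have in_ := ltn_ord i; have := pE (n.-1 - i)%N.
have -> : (n.-1 - (n.-1 - i) = i)%N by lia.
have -> : ((n.-1 - i).+1 = n - i)%N by lia.
by apply; lia.
Qed.
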